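(* Let $r_1,r_2,m_1,m_2>0$ with $r_1+r_2\le1$ and $m_1+m_2=1$, and let $\mu$ be the self-similar measure on $[0,1]$ determined by $S_1(x)=r_1x$, $S_2(x)=r_2x+1-r_2$ and weights $(m_1,m_2)$. Write $p_n=p_n(1)$, $q_n=q_n(1)$. Then for every $n\in\mathbb{N}=\{1,2,\dots\}$ (empty sums being zero): (i) $$p_{2n+1}=\frac{1}{1-r_1^n m_1^{n+1}-r_2^n m_2^{n+1}}\Bigl(\sum_{i=0}^{n-1}r_1^i m_1^{i+1}(r_2m_2)^{n-i}p_{2i+1}q_{2n-2i}+\sum_{i=1}^n(r_1m_1)^i r_2^{n-i}m_2^{n-i+1}p_{2i}p_{2n-2i+1}+[1-(r_1+r_2)]\sum_{i=0}^{n-1}r_1^i m_1^{i+1}r_2^{n-i-1}m_2^{n-i}p_{2i+1}p_{2n-2i-1}\Bigr);$$ (ii) $$p_{2n}=\frac{1}{1-(r_1m_1)^n-(r_2m_2)^n}\Bigl(\sum_{i=1}^{n-1}(r_1m_1)^i(r_2m_2)^{n-i}p_{2i}p_{2n-2i}+\sum_{i=0}^{n-1}r_1^i m_1^{i+1}r_2^{n-i}m_2^{n-i-1}p_{2i+1}q_{2n-2i-1}+[1-(r_1+r_2)]\sum_{i=0}^{n-1}r_1^i m_1^{i+1}(r_2m_2)^{n-i-1}p_{2i+1}p_{2n-2i-2}\Bigr);$$ (iii) $$q_{2n+1}=\frac{1}{1-r_1^{n+1}m_1^n-r_2^{n+1}m_2^n}\Bigl(\sum_{i=0}^{n-1}r_1^{i+1}m_1^i(r_2m_2)^{n-i}q_{2i+1}p_{2n-2i}+\sum_{i=1}^n(r_1m_1)^i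 r_2^{n-i+1}m_2^{n-i}q_{2i}q_{2n-2i+1}+[1-(r_1+r_2)]\sum_{i=0}^n(r_1m_1)^i(r_2m_2)^{n-i}q_{2i}p_{2n-2i}\Bigr);$$ (iv) $$q_{2n}=\frac{1}{1-(r_1m_1)^n-(r_2m_2)^n}\Bigl(\sum_{i=1}^{n-1}(r_1m_1)^i(r_2m_2)^{n-i}q_{2i}q_{2n-2i}+\sum_{i=0}^{n-1}r_1^{i+1}m_1^i r_2^{n-i-1}m_2^{n-i}q_{2i+1}p_{2n-2i-1}+[1-(r_1+r_2)]\sum_{i=0}^{n-1}(r_1m_1)^i r_2^{n-i-1}m_2^{n-i}q_{2i}p_{2n-2i-1}\Bigr).$$
   Context: The self-similar measure $\mu$ is the unique Borel probability measure on $[0,1]$ with $\mu(B)=m_1\,\mu(S_1^{-1}(B))+m_2\,\mu(S_2^{-1}(B))$ for all Borel sets $B$ (it is non-atomic). Functions $p_n,q_n$: for $x\in[0,1]$ put $p_0(x)=q_0(x)=1$ and, for $n\ge1$: for odd $n$, $p_n(x)=\int_0^x p_{n-1}(t)\,d\mu(t)$ and $q_n(x)=\int_0^x q_{n-1}(t)\,dt$; for even $n$, $p_n(x)=\int_0^x p_{n-1}(t)\,dt$ and $q_n(x)=\int_0^x q_{n-1}(t)\,d\mu(t)$. *)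

(* Defs.v *)
From mathcomp Require Import all_boot all_order all_algebra.
From mathcomp Require Import all_classical all_reals all_analysis.
Set Implicit Arguments.
Unset Strict Implicit.
Unset Printing Implicit Defensive.
Import Order.TTheory GRing.Theory Num.Theory.
Import numFieldNormedType.Exports.
Local Open Scope classical_set_scope.
Local Open Scope ring_scope.

Section SelfSimilar.
Context {R : realType}.

Definition S1 (r1 : R) (x : R) : R := r1 * x.
Definition S2 (r2 : R) (x : R) : R := r2 * x + 1 - r2.

(* A Borel probability measure on [0, 1] is encoded as a Borel probability
   measure on the line that gives full mass to [0, 1]. *)
Definition self_similar_measure (r1 r2 m1 m2 : R)
    (mu : probability (measurableTypeR R) R) : Prop :=
  mu `[0, 1]%classic = 1%E /\
  forall B : set (measurableTypeR R), measurable B ->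
    mu B = (m1%:E * mu (S1 r1 @^-1` B) + m2%:E * mu (S2 r2 @^-1` B))%E.

(* Only the values at x in [0, 1] are meaningful.  For odd n, p integrates
   against mu and q against Lebesgue measure; for even n the roles are swapped.
   The integral from 0 to x is taken over the closed interval, which is harmless
   because self-similar measures are non-atomic. *)
Fixpoint p_fun (mu : probability (measurableTypeR R) R) (n : nat) (x : R) : R :=
  match n with
  | 0 => 1
  | k.+1 => if odd n then \int[mu]_(t in `[0, x]%classic) p_fun mu k t
            else \int[lebesgue_measure]_(t in `[0, x]%classic) p_fun mu k t
  end.

Fixpoint q_fun (mu : probability (measurableTypeR R) R) (n : nat) (x : R) : R :=
  match n with
  | 0 => 1
  | k.+1 => if odd n then \int[lebesgue_measure]_(t in `[0, x]%classic) q_fun mu k t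
            else \int[mu]_(t in `[0, x]%classic) q_fun mu k t
  end.

Definition p_ (mu : probability (measurableTypeR R) R) (n : nat) : R :=
  p_fun mu n 1.
Definition q_ (mu : probability (measurableTypeR R) R) (n : nat) : R :=
  q_fun mu n 1.

End SelfSimilar.

Arguments p_ {R} mu n%_N.
Arguments q_ {R} mu n%_N.

(* Main.v *)
(* Both [mu] and Lebesgue measure are reproduced, up to a factor, by [S1] and
   [S2] on the images of these maps, and [mu] does not charge the gap
   ]r1, 1 - r2] between them.  The iterated integral p_n(1) runs over ordered
   tuples t_1 <= ... <= t_n in [0, 1].  Sorting these tuples by the number of t_i
   in the image of [S1], in the gap (at most one, and only a Lebesgue variable,
   since the two measures alternate and [mu] vanishes there) and in the image of
   [S2] factors each contribution into smaller iterated integrals; the two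
   extreme cases reproduce multiples of p_n(1), and solving for it gives the
   recursion. *)
Require Import Defs.
From mathcomp Require Import all_boot all_order all_algebra.
From mathcomp Require Import all_classical all_reals all_analysis.
From mathcomp Require Import measurable_realfun zify ring lra.
Import Order.TTheory GRing.Theory Num.Theory.
Import numFieldNormedType.Exports.
Local Open Scope classical_set_scope.
Local Open Scope ring_scope.

(** * Change of variables and integrals of monotone functions *)

(** Restricting to subsets of [D] is what leaves one map and one factor: on the image of one map,
    the other term of the self-similarity identity vanishes. *)
Definition copies {R : realType} (nu : set (measurableTypeR R) -> \bar R)
    (S : R -> R) (w : R) (D : set R) : Prop :=
  forall B : set (measurableTypeR R), measurable B -> B `<=` D ->
    nu B = (w%:E * nu (S @^-1` B))%E.

Lemma Rintegral_copy {R : realType}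
    {nu : {measure set (measurableTypeR R) -> \bar R}} {S : R -> R} {w : R}
    {D A : set R} {f : R -> R} :
  0 < w -> {homo S : x y / x <= y} -> copies nu S w D ->
  measurable (A : set (measurableTypeR R)) -> A `<=` D ->
  {homo f : x y / x <= y} -> (forall x, 0 <= f x) ->
  \int[nu]_(t in A) f t = w * \int[nu]_(t in S @^-1` A) f (S t).
Proof.
move=> w0 homoS nuS mA AD homof f0.
have mS : measurable_fun setT (S : measurableTypeR R -> measurableTypeR R).
  exact: nondecreasing_measurable.
have mf : measurable_fun A (fun t => (f t)%:E).
  by apply/measurable_EFinP; exact: nondecreasing_measurable.
pose wn := NngNum (ltW w0).
pose pf : {measure set (measurableTypeR R) -> \bar R} :=
  measure_function_pushforward__canonical__measure_function_Measure nu mS.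
rewrite /Rintegral.
rewrite (@eq_measure_integral _ _ _ _ (mscale wn pf)); last first.
  move=> B mB BA; rewrite nuS//; exact: subset_trans BA AD.
rewrite ge0_integral_mscale//; last by move=> x _; rewrite lee_fin.
rewrite ge0_integral_pushforward//; last by move=> x _; rewrite lee_fin.
rewrite /=.
(* An infinite integral is harmless: [fine] sends it to 0, and since [w] is positive both sides
   become 0. *)
have : (0 <= \int[nu]_(x in S @^-1` A) (f (S x))%:E)%E.
  by apply: integral_ge0 => x _; rewrite lee_fin.
case: (integral _ _ _) => [x _|_|//] //=.
by rewrite gt0_muley ?lte_fin//= mulr0.
Qed.

(** Monotonicity is the regularity carried through all the integrals: it gives measurability, and on
    [[a, b]] it bounds [f] by its values at the endpoints. *)
Lemma integrable_nondecreasing (R : realType)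
    (nu : {measure set (measurableTypeR R) -> \bar R}) (f : R -> R) (a b : R)
    (D : set (measurableTypeR R)) :
  measurable D -> D `<=` `[a, b] -> (nu D < +oo)%E ->
  {homo f : x y / x <= y} -> nu.-integrable D (EFin \o f).
Proof.
move=> mD Dab nuD homof; apply: measurable_bounded_integrable => //.
  exact: nondecreasing_measurable.
exists (Num.max `|f a| `|f b|); split; first exact: num_real.
move=> M leM x /= /Dab; rewrite /= in_itv/= => /andP[ax xb].
move: leM; rewrite gt_max => /andP[faM fbM].
rewrite ler_norml; apply/andP; split.
  apply: le_trans (homof _ _ ax); rewrite lerNl.
  by apply: le_trans (ltW faM); rewrite -normrN ler_norm.
by apply: le_trans (homof _ _ xb) _; exact: le_trans (ler_norm _) (ltW fbM).
Qed.

Lemma nondecreasing_Rintegral (R : realType)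
    (nu : {measure set (measurableTypeR R) -> \bar R}) (f : R -> R) :
  (forall x : R, nu `[0%R, x]%classic < +oo)%E ->
  {homo f : x y / x <= y} -> (forall x, 0 <= f x) ->
  {homo (fun x => \int[nu]_(t in `[0, x]%classic) f t) : x y / x <= y}.
Proof.
move=> nufin homof f0 x y xy.
have int z : (\int[nu]_(t in `[0%R, z]) (f t)%:E)%E \is a fin_num.
  apply: integrable_fin_num => //.
  by apply: (@integrable_nondecreasing _ _ _ 0 z) => //; exact: subset_refl.
apply: fine_le => //; apply: ge0_subset_integral => //.
- by apply/measurable_EFinP; exact: nondecreasing_measurable.
- by move=> t _; rewrite lee_fin.
- by apply: subset_itvl; rewrite bnd_simp.
Qed.

(** The preimage of []a, b]] has length (b - a) / r, so the pushforward scaled by [r] gives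
    intervals their length; uniqueness of Lebesgue measure does the rest. *)
Lemma copies_lebesgue (R : realType) (S : R -> R) (r c : R) (D : set R) :
  0 < r -> (forall x, S x = r * x + c) -> copies lebesgue_measure S r D.
Proof.
move=> r0 SE B mB _.
have mS : measurable_fun setT (S : measurableTypeR R -> measurableTypeR R).
  apply: nondecreasing_measurable => // x y xy; rewrite !SE lerD2r.
  by rewrite ler_pM2l.
pose rn := NngNum (ltW r0).
pose pf : {measure set (measurableTypeR R) -> \bar R} :=
  measure_function_pushforward__canonical__measure_function_Measure
    lebesgue_measure mS.
have := @lebesgue_measure_unique R (mscale rn pf) _ B mB; apply.
move=> _ [[a b] _ <-] /=.
rewrite /mscale/= /pushforward.
have -> : S @^-1` `]a, b] = `](a - c) / r, (b - c) / r]%classic.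
  apply/seteqP; split => x /=; rewrite !in_itv/= SE;
    by rewrite ltr_pdivrMr// ler_pdivlMr// ltrBlDr lerBrDr mulrC.
rewrite !lebesgue_measure_itv/= !lte_fin ltr_pM2r ?invr_gt0// ltrD2r.
case: ifP => _; last by rewrite mule0.
rewrite -!EFinB -EFinM; congr EFin; field; exact: lt0r_neq0.
Qed.

Lemma Rintegral_sum d (T : measurableType d) (R : realType)
    (nu : {measure set T -> \bar R}) (I : Type) (s : seq I) (F : I -> T -> R)
    (D : set T) :
  measurable D -> (forall i, nu.-integrable D (EFin \o F i)) ->
  \int[nu]_(t in D) (\sum_(i <- s) F i t) =
  \sum_(i <- s) \int[nu]_(t in D) F i t.
Proof.
move=> mD intF; elim: s => [|i s IHs].
  under eq_Rintegral do rewrite big_nil.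
  by rewrite Rintegral_cst// mul0r big_nil.
under eq_Rintegral do rewrite big_cons.
rewrite RintegralD// ?IHs ?big_cons//.
rewrite [X in _.-integrable _ X](_ : _ = fun t => (\sum_(i <- s) (F i t)%:E)%E).
  by apply: integrable_sum => // j _; exact: intF.
by apply/funext => t /=; rewrite sumEFin.
Qed.

Lemma Rintegral_itv_split (R : realType)
    (nu : {measure set (measurableTypeR R) -> \bar R}) (f : R -> R) (a b : R) :
  (nu `[0%R, b]%classic < +oo)%E -> {homo f : x y / x <= y} -> 0 <= a <= b ->
  \int[nu]_(t in `[0, b]%classic) f t =
  \int[nu]_(t in `[0, a]%classic) f t + \int[nu]_(t in `]a, b]%classic) f t.
Proof.
move=> nub homof /andP[a0 ab].
have E : `[0, b]%classic = `[0, a]%classic `|` `]a, b]%classic :> set R.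
  by rewrite -itv_bndbnd_setU// bnd_simp.
rewrite E Rintegral_setU//.
- rewrite -E; apply: (@integrable_nondecreasing _ _ _ 0 b) => //.
- apply/disj_setPS => x /= []; rewrite !in_itv/= => /andP[_ xa] /andP[ax _].
  by move: (lt_le_trans ax xa); rewrite ltxx.
Qed.

Lemma Rintegral_null (R : realType)
    (nu : {measure set (measurableTypeR R) -> \bar R}) (f : R -> R)
    (N : set (measurableTypeR R)) :
  measurable N -> {homo f : x y / x <= y} -> nu N = 0%E ->
  \int[nu]_(t in N) f t = 0.
Proof.
move=> mN homof nuN; rewrite /Rintegral null_set_integral//.
by apply/measurable_EFinP; exact: nondecreasing_measurable.
Qed.

(** * Null sets and scaling of the self-similar measure *)

Section SelfSimilarMeasure.
Context {R : realType} {r1 r2 m1 m2 : R}.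
Context (hr1 : 0 < r1) (hr2 : 0 < r2) (hm1 : 0 < m1) (hm2 : 0 < m2).
Context (hr : r1 + r2 <= 1) (hm : m1 + m2 = 1).
Context (mu : probability (measurableTypeR R) R).
Context (hmu : self_similar_measure r1 r2 m1 m2 mu).

Let m1_lt1 : m1 < 1.
Proof. by rewrite -hm ltrDl. Qed.

Let m2_lt1 : m2 < 1.
Proof. by rewrite -hm ltrDr. Qed.

Let r1_le : r1 <= 1 - r2.
Proof. by rewrite lerBrDr. Qed.

Let r1_lt1 : r1 < 1.
Proof. by apply: lt_le_trans hr; rewrite ltrDl. Qed.

Let r2_lt1 : r2 < 1.
Proof. by apply: lt_le_trans hr; rewrite ltrDr. Qed.

Let mS1 : measurable_fun setT (S1 r1 : measurableTypeR R -> measurableTypeR R).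
Proof.
by apply: nondecreasing_measurable => // x y xy; rewrite /S1 ler_pM2l.
Qed.

Let mS2 : measurable_fun setT (S2 r2 : measurableTypeR R -> measurableTypeR R).
Proof.
apply: nondecreasing_measurable => // x y xy.
by rewrite /S2 lerD2r lerD2r ler_pM2l.
Qed.

Let mS1V (B : set (measurableTypeR R)) :
  measurable B -> measurable (S1 r1 @^-1` B).
Proof. by move=> mB; rewrite -[X in measurable X]setTI; exact: mS1. Qed.

Let mS2V (B : set (measurableTypeR R)) :
  measurable B -> measurable (S2 r2 @^-1` B).
Proof. by move=> mB; rewrite -[X in measurable X]setTI; exact: mS2. Qed.

Let m01 : measurable (~` `[0%R, 1%R] : set (measurableTypeR R)).
Proof. by apply: measurableC; exact: measurable_itv. Qed.

Let mu_out : mu (~` `[0%R, 1%R]%classic) = 0%E.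
Proof. by rewrite probability_setC// hmu.1 subee. Qed.

(** Used at the endpoints: 0 is fixed by [S1] and 1 by [S2], so a mass [a] there satisfies a = m a
    with m < 1. *)
Let fixed_null (z m : R) : 0 < m < 1 -> mu [set z] = (m%:E * mu [set z])%E ->
  mu [set z] = 0%E.
Proof.
move=> /andP[m0 ml1].
have : mu [set z] \is a fin_num by exact: fin_num_measure.
case: (mu [set z]) => //= a _; rewrite -EFinM => -[am]; congr EFin.
have : (1 - m) * a = 0 by rewrite mulrBl mul1r -am subrr.
by move/eqP; rewrite mulf_eq0 => /orP[/eqP|/eqP//]; lra.
Qed.

Lemma mu_set0 : mu [set 0] = 0%E.
Proof.
apply: (@fixed_null 0 m1); first exact/andP.
rewrite [LHS]hmu.2//.
have -> : S1 r1 @^-1` [set 0] = [set 0].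
  apply/seteqP; split => x /=; rewrite /S1; last by move=> ->; rewrite mulr0.
  by move/eqP; rewrite mulf_eq0 gt_eqF//= => /eqP.
(* The only preimage of 0 under [S2] is 1 - 1 / r2, which is negative. *)
rewrite (_ : mu (S2 r2 @^-1` _) = 0%E) ?mule0 ?adde0//.
apply: (subset_measure0 _ m01 _ mu_out); first exact: mS2V.
move=> x /=; rewrite /S2 in_itv/= => E; apply/negP; rewrite negb_and -!ltNge.
apply/orP; left; rewrite ltNge; apply/negP => x0.
by have := mulr_ge0 (ltW hr2) x0; have := r2_lt1; lra.
Qed.

Lemma mu_set1 : mu [set 1] = 0%E.
Proof.
apply: (@fixed_null 1 m2); first exact/andP.
rewrite [LHS]hmu.2//.
have -> : S2 r2 @^-1` [set 1] = [set 1].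
  apply/seteqP; split => x /=; rewrite /S2; last first.
    by move=> ->; rewrite mulr1; lra.
  move=> E; have /eqP : r2 * (x - 1) = 0 by lra.
  by rewrite mulf_eq0 gt_eqF//= => /eqP; lra.
rewrite (_ : mu (S1 r1 @^-1` _) = 0%E) ?mule0 ?add0e//.
apply: (subset_measure0 _ m01 _ mu_out); first exact: mS1V.
move=> x /=; rewrite /S1 in_itv/= => E; apply/negP; rewrite negb_and -!ltNge.
apply/orP; right; rewrite ltNge -subr_ge0; apply/negP => x1.
by have := mulr_ge0 (ltW hr1) x1; have := r1_lt1; lra.
Qed.

(** The endpoints have to belong to this null set: the two images touch when r1 + r2 = 1, and the
    gap []r1, 1 - r2]] contains [1 - r2], the image of 0 under [S2]. *)
Let N := ~` `]0%R, 1%R[ : set (measurableTypeR R).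

Let mN : measurable N.
Proof. by apply: measurableC; exact: measurable_itv. Qed.

Let mu_N : mu N = 0%E.
Proof.
apply: (@subset_measure0 _ _ _ mu _
  (~` `[0%R, 1%R] `|` ([set 0] `|` [set 1]))) => //.
- by do 2 apply: measurableU => //.
- move=> x; rewrite /N /= !in_itv/=.
  have [x0|x0|->] := ltgtP x 0; [by left| |by right; left].
  have [x1|x1|->] := ltgtP x 1; [by []|by left|by right; right].
- apply/null_set_setU => //; first exact: measurableU.
  by apply/null_set_setU => //; [exact: mu_set0|exact: mu_set1].
Qed.

(** If [S2 r2 x] is at most [r1], hence at most [1 - r2], then x <= 0; the [S2] term is therefore
    null. *)
Lemma mu_copies1 : copies mu (S1 r1) m1 `[0, r1]%classic.
Proof.
move=> B mB BD; rewrite [LHS]hmu.2//.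
rewrite (_ : mu (S2 r2 @^-1` _) = 0%E) ?mule0 ?adde0//.
apply: (subset_measure0 _ mN _ mu_N); first exact: mS2V.
move=> x /= /BD /=; rewrite !in_itv/= /S2 => /andP[_ le]; apply/negP.
rewrite negb_and -!leNgt; apply/orP; left; rewrite leNgt; apply/negP => x0.
by have := mulr_gt0 hr2 x0; have := r1_le; lra.
Qed.

Lemma mu_copies2 : copies mu (S2 r2) m2 `[1 - r2, 1]%classic.
Proof.
move=> B mB BD; rewrite [LHS]hmu.2//.
rewrite (_ : mu (S1 r1 @^-1` _) = 0%E) ?mule0 ?add0e//.
apply: (subset_measure0 _ mN _ mu_N); first exact: mS1V.
move=> x /= /BD /=; rewrite !in_itv/= /S1 => /andP[le _]; apply/negP.
rewrite negb_and -!leNgt; apply/orP; right.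
rewrite leNgt -subr_gt0; apply/negP => x1.
by have := mulr_gt0 hr1 x1; have := r1_le; lra.
Qed.

Lemma mu_gap : mu `]r1, 1 - r2]%classic = 0%E.
Proof.
rewrite [LHS]hmu.2//.
rewrite (_ : mu (S1 r1 @^-1` _) = 0%E); last first.
  apply: (subset_measure0 _ mN _ mu_N);
  first by apply: mS1V; exact: measurable_itv.
  move=> x /=; rewrite !in_itv/= /S1 => /andP[le _]; apply/negP.
  rewrite negb_and -!leNgt; apply/orP; right.
  rewrite leNgt -subr_gt0; apply/negP => x1.
  by have := mulr_gt0 hr1 x1; have := r1_le; lra.
rewrite (_ : mu (S2 r2 @^-1` _) = 0%E) ?mule0 ?adde0//.
apply: (subset_measure0 _ mN _ mu_N);
  first by apply: mS2V; exact: measurable_itv.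
move=> x /=; rewrite !in_itv/= /S2 => /andP[_ le]; apply/negP.
rewrite negb_and -!leNgt; apply/orP; left; rewrite leNgt; apply/negP => x0.
by have := mulr_gt0 hr2 x0; have := r1_le; lra.
Qed.

(** * The two alternating measures and their iterated integrals *)

(** Indexing the measures by a Boolean lets one induction treat p and q together. *)
Let nu (b : bool) : {measure set (measurableTypeR R) -> \bar R} :=
  if b then (mu : {measure set (measurableTypeR R) -> \bar R})
  else lebesgue_measure.

Let nu_fin b (x : R) : (nu b `[0%R, x]%classic < +oo)%E.
Proof.
case: b => /=.
  by apply: (@le_lt_trans _ _ 1%E); [exact: probability_le1|exact: ltry].
by rewrite lebesgue_measure_itv/=; case: ifP => _; rewrite -?EFinB ltry.
Qed.

Let nu_set0 b : nu b [set 0] = 0%E.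
Proof. by case: b => /=; [exact: mu_set0|exact: lebesgue_measure_set1]. Qed.

Definition ratio (r m : R) (b : bool) : R := if b then m else r.

Let ratio_gt0 r m b : 0 < r -> 0 < m -> 0 < ratio r m b.
Proof. by case: b. Qed.

Let nu_copies1 b : copies (nu b) (S1 r1) (ratio r1 m1 b) `[0, r1]%classic.
Proof.
case: b => /=; first exact: mu_copies1.
by apply: (@copies_lebesgue _ _ _ 0) => // x; rewrite /S1 addr0.
Qed.

Let nu_copies2 b : copies (nu b) (S2 r2) (ratio r2 m2 b) `[1 - r2, 1]%classic.
Proof.
case: b => /=; first exact: mu_copies2.
by apply: (@copies_lebesgue _ _ _ (1 - r2)) => // x; rewrite /S2 addrA.
Qed.

Let Rintegral_nu_S1 b (f : R -> R) x :
  {homo f : x y / x <= y} -> (forall x, 0 <= f x) -> 0 <= x <= 1 ->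
  \int[nu b]_(t in `[0, r1 * x]%classic) f t =
  ratio r1 m1 b * \int[nu b]_(t in `[0, x]%classic) f (r1 * t).
Proof.
move=> homof f0 /andP[x0 x1].
rewrite (Rintegral_copy _ _ (nu_copies1 b))//.
- congr (_ * Rintegral _ _ _); apply/seteqP; split => t /=;
  by rewrite !in_itv/= /S1 pmulr_rge0// ler_pM2l.
- exact: ratio_gt0.
- by move=> s t st; rewrite /S1 ler_pM2l.
- by apply: subset_itvl; rewrite bnd_simp -[leRHS]mulr1 ler_pM2l.
Qed.

Let Rintegral_nu_S2 b (f : R -> R) x :
  {homo f : x y / x <= y} -> (forall x, 0 <= f x) -> 0 <= x <= 1 ->
  \int[nu b]_(t in `[0, S2 r2 x]%classic) f t =
  \int[nu b]_(t in `[0, 1 - r2]%classic) f t +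
  ratio r2 m2 b * \int[nu b]_(t in `[0, x]%classic) f (S2 r2 t).
Proof.
move=> homof f0 /andP[x0 x1].
have homoS2 : {homo S2 r2 : s t / s <= t}.
  by move=> s t st; rewrite /S2 !lerD2r ler_pM2l.
have r2x : 0 <= r2 * x by apply: mulr_ge0 => //; exact: ltW.
rewrite (@Rintegral_itv_split _ _ _ (1 - r2))//; last first.
  by rewrite subr_ge0 ltW//= /S2 -addrA lerDr.
congr (_ + _).
rewrite (Rintegral_copy _ homoS2 (nu_copies2 b))//; last 2 first.
- exact: ratio_gt0.
- move=> t /=; rewrite !in_itv/= => /andP[/ltW -> tx]/=.
  apply: le_trans tx _; rewrite /S2 -addrA -lerBrDr opprB addrCA subrr addr0.
  by rewrite -[leRHS]mulr1 ler_pM2l.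
congr (_ * _).
(* The part above [1 - r2] pulls back to []0, x]]; closing it at 0 changes nothing, since neither
   measure charges that point. *)
rewrite [RHS](@Rintegral_itv_split _ _ _ 0)//; last 2 first.
- by move=> s t st; apply: homof; apply: homoS2.
- by rewrite lexx.
rewrite set_itv1 [X in _ = X + _]Rintegral_null ?nu_set0 ?add0r//; last first.
  by move=> s t st; apply: homof; apply: homoS2.
congr Rintegral; apply/seteqP; split => t /=;
  by rewrite !in_itv/= /S2 !lerD2r ler_pM2l// -addrA ltrDr pmulr_rgt0.
Qed.

(* [chain true] is the paper's p and [chain false] is q: the Boolean tells
   whether the innermost integral is taken against [mu]. *)
Fixpoint chain (b : bool) (n : nat) (x : R) : R :=
  if n is k.+1 then \int[nu (odd n == b)]_(t in `[0, x]%classic) chain b k t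
  else 1.

(** The total factor gained when all [n] variables of [chain b n] are rescaled by one map. *)
Fixpoint weight (r m : R) (b : bool) (n : nat) : R :=
  if n is k.+1 then ratio r m (odd n == b) * weight r m b k else 1.

Lemma p_fun_chain n x : p_fun mu n x = chain true n x.
Proof.
elim: n x => [//|n IHn] x /=.
by case: (odd n); apply: eq_Rintegral => t _; exact: IHn.
Qed.

Lemma q_fun_chain n x : q_fun mu n x = chain false n x.
Proof.
elim: n x => [//|n IHn] x /=.
by case: (odd n); apply: eq_Rintegral => t _; exact: IHn.
Qed.

Lemma chain_ge0 b n x : 0 <= chain b n x.
Proof. by elim: n x => [|n IHn] x //=; apply: Rintegral_ge0. Qed.

Lemma chain_nondecreasing b n : {homo chain b n : x y / x <= y}.
Proof.
elim: n => [//|n IHn]; apply: nondecreasing_Rintegral => //; exact: chain_ge0.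
Qed.

Let integrable_chain b b' n x :
  (nu b).-integrable `[0%R, x] (EFin \o chain b' n).
Proof.
apply: (@integrable_nondecreasing _ _ _ 0 x) => //.
exact: chain_nondecreasing.
Qed.

(** * Iterated integrals under the two maps and across the gap *)

(** All variables lie below [r1 * x], hence in the image of [S1], and each substitution releases one
    ratio. *)
Lemma chain_S1 b n x : 0 <= x <= 1 ->
  chain b n (r1 * x) = weight r1 m1 b n * chain b n x.
Proof.
elim: n x => [|n IHn] x x01; first by rewrite mulr1.
rewrite [LHS]/= Rintegral_nu_S1//;
  [|exact: chain_nondecreasing|exact: chain_ge0].
rewrite -mulrA; congr (_ * _); rewrite -RintegralZl//.
apply: eq_Rintegral => t; rewrite inE/= in_itv/= => /andP[t0 tx].
by rewrite IHn// t0 (le_trans tx)//; case/andP: x01.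
Qed.

(* [j] counts the integration variables that are at most [1 - r2], i.e. lie in
   the image of [S1] or in the gap; the other [n - j] lie in the image of
   [S2]. *)
Lemma chain_S2 b n x : 0 <= x <= 1 ->
  chain b n (S2 r2 x) =
  \sum_(0 <= j < n.+1) weight r2 m2 (b (+) odd j) (n - j) *
                       chain b j (1 - r2) * chain (b (+) odd j) (n - j) x.
Proof.
elim: n x => [|n IHn] x x01; first by rewrite big_nat1/= !mulr1.
rewrite [LHS]/= Rintegral_nu_S2//;
  [|exact: chain_nondecreasing|exact: chain_ge0].
(* The last term, j = n + 1, is the integral over [[0, 1 - r2]]; the other terms come from the
   induction hypothesis under the remaining integral. *)
rewrite big_nat_recr//= subnn/= mul1r mulr1 addrC; congr (_ + _).
transitivity (ratio r2 m2 (odd n.+1 == b) *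
  \int[nu (odd n.+1 == b)]_(t in `[0, x]%classic)
    \sum_(0 <= j < n.+1) weight r2 m2 (b (+) odd j) (n - j) *
                         chain b j (1 - r2) * chain (b (+) odd j) (n - j) t).
  congr (_ * _).
  apply: eq_Rintegral => t; rewrite inE/= in_itv/= => /andP[t0 tx].
  by rewrite IHn// t0 (le_trans tx)//; case/andP: x01.
rewrite Rintegral_sum//; last first.
  move=> j; rewrite /= (_ : _ \o _ = fun t =>
    ((weight r2 m2 (b (+) odd j) (n - j) * chain b j (1 - r2))%:E *
     (chain (b (+) odd j) (n - j) t)%:E)%E).
    by apply: integrableZl => //; exact: integrable_chain.
  by apply/funext => t.
rewrite big_distrr/=; apply: eq_big_nat => j /andP[_ jn].
rewrite ltnS in jn.
rewrite RintegralZl// subSn//=.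
(* Dropping the [j] innermost variables flips the starting measure [j] times but leaves the
   outermost measure unchanged. *)
rewrite (_ : (~~ odd (n - j) == b (+) odd j) = (~~ odd n == b)).
  by rewrite !mulrA.
by rewrite oddB//; case: (odd n) (odd j) {IHn} b => [] [] [].
Qed.

(** Only the outermost variable can contribute in the gap, and only if it is a Lebesgue variable:
    the next one is then integrated against [mu], so the integrand is constant across the gap and
    the gap length factors out. *)
Lemma chain_gap b n :
  chain b n (1 - r2) = weight r1 m1 b n * chain b n 1 +
    (if (0 < n)%N && (odd n != b)
     then (1 - (r1 + r2)) * (weight r1 m1 b n.-1 * chain b n.-1 1) else 0).
Proof.
have homo k := @chain_nondecreasing b k.
have r1_ge0 : 0 <= r1 by exact: ltW.
(* With [mu] outermost, the integral does not change across the gap. *)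
have gapmu k y : r1 <= y <= 1 - r2 -> odd k.+1 == b ->
    chain b k.+1 y = chain b k.+1 r1.
  move=> /andP[r1y yr2] kb.
  rewrite /= (@Rintegral_itv_split _ _ _ r1)//; last by rewrite r1_ge0.
  rewrite [X in _ + X]Rintegral_null ?addr0//.
  move: kb => /= kb; rewrite kb /nu.
  apply: (subset_measure0 _ _ _ mu_gap) => //.
  by apply: subset_itvl; rewrite bnd_simp.
have chain_r1 k : chain b k r1 = weight r1 m1 b k * chain b k 1.
  by rewrite -chain_S1 ?mulr1// ler01 lexx.
case: n => [|n]; first by rewrite /= !mulr1 addr0.
rewrite -!chain_r1 /=.
case: ifPn => [|]; last first.
  by rewrite negbK => nb; rewrite addr0; apply: gapmu => //; rewrite r1_le lexx.
move=> nb.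
rewrite /= (@Rintegral_itv_split _ _ _ r1)//; last by rewrite r1_ge0.
congr (_ + _).
rewrite (_ : \int[_]_(_ in _) _ =
  \int[nu (~~ odd n == b)]_(t in `]r1, 1 - r2]%classic) chain b n r1).
  rewrite Rintegral_cst// (negbTE nb) /= lebesgue_measure_itv/=.
  (* An empty gap forces r1 = 1 - r2, so the length factor is 0 as well. *)
  rewrite lte_fin; case: ifPn => [_|].
    by rewrite -EFinB/= mulrC opprD addrA addrAC.
  rewrite -leNgt => r1r2; have -> : 1 - (r1 + r2) = 0.
    by move: r1_le r1r2; lra.
  by rewrite mulr0 mul0r.
apply: eq_Rintegral => t; rewrite inE/= in_itv/= => /andP[t0 tx].
(* For no inner variable the integrand is the constant 1; otherwise its outermost measure is [mu]
   and [gapmu] applies. *)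
case: n nb => [//|n] nb.
apply: gapmu; first by rewrite ltW.
by move: nb => /=; case: (odd n) (b) => [] [].
Qed.

(** * The recursion and its denominator *)

(** As [S2] fixes 1, [chain_S2] at 1 expands the value, and [chain_gap] evaluates the factors at
    [1 - r2]. The terms with all variables in a single image move to the left. In the gap sum, [j]
    variables lie in the image of [S1] and the next is the Lebesgue variable in the gap, so the
    remaining chain starts with [mu]: hence [true]. *)
Lemma chain_recursion b n : (0 < n)%N ->
  (1 - weight r1 m1 b n - weight r2 m2 b n) * chain b n 1 =
  \sum_(1 <= j < n)
     weight r1 m1 b j * weight r2 m2 (b (+) odd j) (n - j) *
     (chain b j 1 * chain (b (+) odd j) (n - j) 1) +
  (1 - (r1 + r2)) *
  \sum_(0 <= j < n | odd j == b)
     weight r1 m1 b j * weight r2 m2 true (n - j.+1) *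
     (chain b j 1 * chain true (n - j.+1) 1).
Proof.
case: n => // n _.
have S21 : S2 r2 1 = 1 by rewrite /S2 mulr1 addrAC subrr add0r.
have /(@chain_S2 b n.+1) : 0 <= (1 : R) <= 1 by rewrite ler01 lexx.
rewrite S21.
under eq_bigr do rewrite chain_gap mulrDr mulrDl.
rewrite big_split/= big_nat_recr//= big_ltn//=.
(* The gap term at j = 0 is zero; shifting the others makes [j] count the variables in the image of
   [S1]. *)
rewrite [X in _ + X]big_ltn//= [X in _ + (_ + X)]big_add1/=.
rewrite subnn addbF !mulr1 mulr0 mul0r add0r /= !mul1r.
set c := _ * Rintegral _ _ _.
move=> E.
rewrite mulrBl mulrBl mul1r [X in X - _ - _]E.
rewrite big_distrr [X in _ = _ + X]big_mkcond/=.
set A := \sum_(1 <= j < n.+1) _; set B := \sum_(0 <= j < n.+1) _.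
set A' := \sum_(1 <= j < n.+1) _; set B' := \sum_(0 <= j < n.+1) _.
have -> : A' = A.
  by apply: eq_bigr => j _; rewrite !mulrA; congr (_ * _ * _); rewrite mulrC.
have -> : B' = B.
  apply: eq_bigr => j _.
  rewrite (_ : (~~ odd j != b) = (odd j == b)); last first.
    by case: (odd j) (b) => [] [].
  case: ifPn => [/eqP jb|_]; last by rewrite mulr0 mul0r.
  by rewrite -jb addbN addbb /=; ring.
by rewrite /c; ring.
Qed.

Lemma weight_le1 r m b n : 0 < r <= 1 -> 0 < m <= 1 -> 0 <= weight r m b n <= 1.
Proof.
move=> /andP[r0 r1'] /andP[m0 m1']; elim: n => [|n /andP[IH0 IH1]] /=.
  by rewrite ler01 lexx.
have /andP[k0 k1] : 0 < ratio r m (~~ odd n == b) <= 1.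
  by rewrite /ratio; case: ifP; rewrite ?r0 ?m0.
by rewrite mulr_ge0 ?(ltW k0)//= mulr_ile1 ?(ltW k0).
Qed.

(** The measures alternate, so the two outermost ratios multiply to r m < m, and the remaining ones
    are at most 1. *)
Lemma weight_lt r m b n : 0 < r < 1 -> 0 < m <= 1 -> weight r m b n.+2 < m.
Proof.
move=> /andP[r0 rl1] /andP[m0 ml1].
have /andP[w0 w1] : 0 <= weight r m b n <= 1.
  by apply: weight_le1; rewrite ?r0 ?m0 ?(ltW rl1).
rewrite /= mulrA (_ : ratio _ _ _ * _ = r * m); last first.
  by rewrite /ratio; case: (odd n) (b) => [] []//=; rewrite mulrC.
apply: (@le_lt_trans _ _ (r * m)); first by rewrite ger_pMr ?mulr_gt0.
by rewrite gtr_pMl.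
Qed.

(** The two weights stay below [m1] and [m2], whose sum is 1. Two variables are required: for one
    variable against [mu] the weights are exactly [m1] and [m2], and the denominator is 0. *)
Lemma chain_denominator_gt0 b n :
  0 < 1 - weight r1 m1 b n.+2 - weight r2 m2 b n.+2.
Proof.
rewrite -addrA -opprD subr_gt0 -hm; apply: ltrD; apply: weight_lt;
  by rewrite ?hr1 ?hr2 ?hm1 ?hm2 ?r1_lt1 ?r2_lt1 ?(ltW m1_lt1) ?(ltW m2_lt1).
Qed.

Lemma chain_formula b n : (1 < n)%N ->
  chain b n 1 = 1 / (1 - weight r1 m1 b n - weight r2 m2 b n) *
  (\sum_(1 <= j < n) weight r1 m1 b j * weight r2 m2 (b (+) odd j) (n - j) *
                    (chain b j 1 * chain (b (+) odd j) (n - j) 1) +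
  (1 - (r1 + r2)) *
  \sum_(0 <= j < n | odd j == b)
     weight r1 m1 b j * weight r2 m2 true (n - j.+1) *
     (chain b j 1 * chain true (n - j.+1) 1)).
Proof.
case: n => [//|[//|n]] _; rewrite -chain_recursion// mulrA divfK ?mul1r//.
by rewrite gt_eqF// chain_denominator_gt0.
Qed.

End SelfSimilarMeasure.

(** * Explicit weights and splitting of sums by parity *)

Lemma weight_even {R : realType} (r m : R) b i :
  weight r m b (2 * i) = (r * m) ^+ i.
Proof.
elim: i => [//|i IHi]; rewrite mulnS /= oddM/= IHi mulrA exprS; congr (_ * _).
by case: b {IHi} => //=; rewrite mulrC.
Qed.

Lemma weight_odd {R : realType} (r m : R) b i :
  weight r m b (2 * i + 1) = ratio r m b * (r * m) ^+ i.
Proof. by rewrite addn1 /= weight_even oddM; case: b. Qed.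

Lemma big_parity {V : nmodType} (F : nat -> V) n :
  \sum_(0 <= j < 2 * n) F j =
  \sum_(0 <= i < n) F (2 * i)%N + \sum_(0 <= i < n) F (2 * i + 1)%N.
Proof.
elim: n => [|n IHn]; first by rewrite !big_nil addr0.
by rewrite mulnS !big_nat_recr//= IHn addn1 addrACA addrA.
Qed.

Lemma big_parity1 {V : zmodType} (F : nat -> V) n : (0 < n)%N ->
  \sum_(1 <= j < 2 * n) F j =
  \sum_(1 <= i < n) F (2 * i)%N + \sum_(0 <= i < n) F (2 * i + 1)%N.
Proof.
move=> n0; apply: (addrI (F 0%N)); rewrite -big_ltn ?muln_gt0// big_parity.
by rewrite [X in X + _ = _]big_ltn// addrA.
Qed.

Lemma big_parity_filter {V : nmodType} (F : nat -> V) (b : bool) n :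
  \sum_(0 <= j < 2 * n | odd j == b) F j = \sum_(0 <= i < n) F (2 * i + b)%N.
Proof.
rewrite big_mkcond big_parity/=.
under eq_bigr do rewrite oddM/=.
under [X in _ + X]eq_bigr do rewrite oddD oddM/=.
case: b => /=; rewrite big1_eq ?addr0 ?add0r//.
by under [RHS]eq_bigr do rewrite addn0.
Qed.

(** Below 2n + 1 there are n odd and n + 1 even numbers; [~~ b], read as a number, supplies the
    extra even one. *)
Lemma big_parityS_filter {V : nmodType} (F : nat -> V) (b : bool) n :
  \sum_(0 <= j < 2 * n + 1 | odd j == b) F j =
  \sum_(0 <= i < n + ~~ b) F (2 * i + b)%N.
Proof.
rewrite addn1 big_mkcond big_nat_recr//= -big_mkcond big_parity_filter oddM/=.
by case: b; rewrite /= ?addr0 ?addn0// addn1 big_nat_recr//= addn0.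
Qed.

Lemma big_parity1S {V : zmodType} (F : nat -> V) n : (0 < n)%N ->
  \sum_(1 <= j < 2 * n + 1) F j =
  \sum_(0 <= i < n) F (2 * i + 1)%N + \sum_(1 <= i < n.+1) F (2 * i)%N.
Proof.
move=> n0; rewrite addn1 big_nat_recr ?muln_gt0// big_parity1//.
by rewrite [in RHS]big_nat_recr//= addrAC addrC.
Qed.

Theorem corollary7p11 (R : realType) (r1 r2 m1 m2 : R)
    (hr1 : 0 < r1) (hr2 : 0 < r2) (hm1 : 0 < m1) (hm2 : 0 < m2)
    (hr : r1 + r2 <= 1) (hm : m1 + m2 = 1)
    (mu : probability (measurableTypeR R) R)
    (hmu : self_similar_measure r1 r2 m1 m2 mu)
    (n : nat) (hn : (1 <= n)%N) :
  [/\ p_ mu (2 * n + 1) =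
      1 / (1 - r1 ^+ n * m1 ^+ (n + 1) - r2 ^+ n * m2 ^+ (n + 1)) *
      (\sum_(0 <= i < n)
          r1 ^+ i * m1 ^+ (i + 1) * (r2 * m2) ^+ (n - i) *
          p_ mu (2 * i + 1) * q_ mu (2 * n - 2 * i)
       + \sum_(1 <= i < n.+1)
          (r1 * m1) ^+ i * r2 ^+ (n - i) * m2 ^+ (n - i + 1) *
          p_ mu (2 * i) * p_ mu (2 * n - 2 * i + 1)
       + (1 - (r1 + r2)) *
         \sum_(0 <= i < n)
          r1 ^+ i * m1 ^+ (i + 1) * r2 ^+ (n - i - 1) * m2 ^+ (n - i) *
          p_ mu (2 * i + 1) * p_ mu (2 * n - 2 * i - 1)),
      p_ mu (2 * n) =
      1 / (1 - (r1 * m1) ^+ n - (r2 * m2) ^+ n) *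
      (\sum_(1 <= i < n)
          (r1 * m1) ^+ i * (r2 * m2) ^+ (n - i) *
          p_ mu (2 * i) * p_ mu (2 * n - 2 * i)
       + \sum_(0 <= i < n)
          r1 ^+ i * m1 ^+ (i + 1) * r2 ^+ (n - i) * m2 ^+ (n - i - 1) *
          p_ mu (2 * i + 1) * q_ mu (2 * n - 2 * i - 1)
       + (1 - (r1 + r2)) *
         \sum_(0 <= i < n)
          r1 ^+ i * m1 ^+ (i + 1) * (r2 * m2) ^+ (n - i - 1) *
          p_ mu (2 * i + 1) * p_ mu (2 * n - 2 * i - 2)),
      q_ mu (2 * n + 1) =
      1 / (1 - r1 ^+ (n + 1) * m1 ^+ n - r2 ^+ (n + 1) * m2 ^+ n) *
      (\sum_(0 <= i < n)
          r1 ^+ (i + 1) * m1 ^+ i * (r2 * m2) ^+ (n - i) *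
          q_ mu (2 * i + 1) * p_ mu (2 * n - 2 * i)
       + \sum_(1 <= i < n.+1)
          (r1 * m1) ^+ i * r2 ^+ (n - i + 1) * m2 ^+ (n - i) *
          q_ mu (2 * i) * q_ mu (2 * n - 2 * i + 1)
       + (1 - (r1 + r2)) *
         \sum_(0 <= i < n.+1)
          (r1 * m1) ^+ i * (r2 * m2) ^+ (n - i) *
          q_ mu (2 * i) * p_ mu (2 * n - 2 * i))
    & q_ mu (2 * n) =
      1 / (1 - (r1 * m1) ^+ n - (r2 * m2) ^+ n) *
      (\sum_(1 <= i < n)
          (r1 * m1) ^+ i * (r2 * m2) ^+ (n - i) *
          q_ mu (2 * i) * q_ mu (2 * n - 2 * i)
       + \sum_(0 <= i < n)
          r1 ^+ (i + 1) * m1 ^+ i * r2 ^+ (n - i - 1) * m2 ^+ (n - i) *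
          q_ mu (2 * i + 1) * p_ mu (2 * n - 2 * i - 1)
       + (1 - (r1 + r2)) *
         \sum_(0 <= i < n)
          (r1 * m1) ^+ i * r2 ^+ (n - i - 1) * m2 ^+ (n - i) *
          q_ mu (2 * i) * p_ mu (2 * n - 2 * i - 1))].
Proof.
have odd0 i : odd (2 * i) = false by rewrite oddM.
have odd1 i : odd (2 * i + 1) = true by rewrite oddD odd0.
have chainp k : chain mu true k 1 = p_ mu k by rewrite -p_fun_chain.
have chainq k : chain mu false k 1 = q_ mu k by rewrite -q_fun_chain.
have formula b k k1 := chain_formula hr1 hr2 hm1 hm2 hr hm mu hmu b k k1.
have n2 : (1 < 2 * n)%N by lia.
have n21 : (1 < 2 * n + 1)%N by lia.
(* Each formula is [chain_formula] with [b] true for p and false for q. Splitting by the parity of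
   [j] decides whether the remaining factor keeps its kind (even [j]) or changes it (odd [j]). *)
split; rewrite -?chainp -?chainq formula// ?weight_odd ?weight_even /=.
- rewrite big_parity1S// big_parityS_filter/= addn0.
  congr (1 / (_ - _ - _) * (_ + _ + _ * _)).
  + by rewrite exprMn exprD; ring.
  + by rewrite exprMn exprD; ring.
  + apply: eq_big_nat => i /andP[_ ni].
    rewrite (_ : (2 * n + 1 - (2 * i + 1) = 2 * (n - i))%N); last by lia.
    rewrite odd1 /= chainp chainq -mulnBr weight_odd weight_even/=.
    by rewrite !exprD ?exprS !exprMn; ring.
  + apply: eq_big_nat => i /andP[_ ni].
    rewrite (_ : (2 * n + 1 - 2 * i = 2 * (n - i) + 1)%N); last by lia.
    rewrite odd0 /= !chainp -mulnBr weight_odd weight_even/=.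
    by rewrite !exprD ?exprS !exprMn; ring.
  + apply: eq_big_nat => i /andP[_ ni].
    rewrite (_ : (2 * n + 1 - (2 * i + 1).+1 = 2 * (n - i - 1) + 1)%N);
      last by lia.
    rewrite (_ : (2 * n - 2 * i - 1 = 2 * (n - i - 1) + 1)%N); last by lia.
    (* As i < n, this subtraction is not truncated; the successor form lets [exprS] relate the
       exponents n - i and n - i - 1. *)
    rewrite (_ : (n - i)%N = (n - i - 1).+1); last by lia.
    rewrite [((n - i - 1).+1 - 1)%N]subn1/= !chainp !weight_odd/=.
    by rewrite !exprD ?exprS !exprMn; ring.
- rewrite big_parity1// big_parity_filter/=.
  congr (_ * (_ + _ + _ * _)).
  + apply: eq_big_nat => i /andP[_ ni].
    rewrite odd0 /= -mulnBr !chainp !weight_even.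
    by ring.
  + apply: eq_big_nat => i /andP[_ ni].
    rewrite (_ : (2 * n - (2 * i + 1) = 2 * (n - i - 1) + 1)%N); last by lia.
    rewrite (_ : (2 * n - 2 * i - 1 = 2 * (n - i - 1) + 1)%N); last by lia.
    rewrite (_ : (n - i)%N = (n - i - 1).+1); last by lia.
    rewrite [((n - i - 1).+1 - 1)%N]subn1/= odd1/= chainp chainq !weight_odd/=.
    by rewrite !exprD ?exprS !exprMn; ring.
  + apply: eq_big_nat => i /andP[_ ni].
    rewrite (_ : (2 * n - (2 * i + 1).+1 = 2 * (n - i - 1))%N); last by lia.
    rewrite (_ : (2 * n - 2 * i - 2 = 2 * (n - i - 1))%N); last by lia.
    rewrite !chainp weight_odd weight_even/=.
    by rewrite !exprD ?exprS !exprMn; ring.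
(* For q the gap sum runs over even [j] up to 2n, which gives n + 1 terms. *)
- rewrite big_parity1S// big_parityS_filter/=.
  rewrite [(n + 1)%N in X in _ * (_ + _ * X)]addn1.
  congr (1 / (_ - _ - _) * (_ + _ + _ * _)).
  + by rewrite exprMn exprD; ring.
  + by rewrite exprMn exprD; ring.
  + apply: eq_big_nat => i /andP[_ ni].
    rewrite (_ : (2 * n + 1 - (2 * i + 1) = 2 * (n - i))%N); last by lia.
    rewrite odd1 /= chainp chainq -mulnBr weight_odd weight_even/=.
    by rewrite !exprD ?exprS !exprMn; ring.
  + apply: eq_big_nat => i /andP[_ ni].
    rewrite (_ : (2 * n + 1 - 2 * i = 2 * (n - i) + 1)%N); last by lia.
    rewrite odd0 /= !chainq -mulnBr weight_odd weight_even/=.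
    by rewrite !exprD ?exprS !exprMn; ring.
  + apply: eq_big_nat => i /andP[_ ni].
    rewrite (_ : (2 * n + 1 - (2 * i + 0).+1 = 2 * (n - i))%N); last by lia.
    rewrite addn0 chainp chainq -mulnBr !weight_even/=.
    by ring.
- rewrite big_parity1// big_parity_filter/=.
  congr (_ * (_ + _ + _ * _)).
  + apply: eq_big_nat => i /andP[_ ni].
    rewrite odd0 /= -mulnBr !chainq !weight_even.
    by ring.
  + apply: eq_big_nat => i /andP[_ ni].
    rewrite (_ : (2 * n - (2 * i + 1) = 2 * (n - i - 1) + 1)%N); last by lia.
    rewrite (_ : (2 * n - 2 * i - 1 = 2 * (n - i - 1) + 1)%N); last by lia.
    rewrite (_ : (n - i)%N = (n - i - 1).+1); last by lia.
    rewrite [((n - i - 1).+1 - 1)%N]subn1/= odd1/= chainp chainq !weight_odd/=.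
    by rewrite !exprD ?exprS !exprMn; ring.
  + apply: eq_big_nat => i /andP[_ ni].
    rewrite (_ : (2 * n - (2 * i + 0).+1 = 2 * (n - i - 1) + 1)%N); last by lia.
    rewrite (_ : (2 * n - 2 * i - 1 = 2 * (n - i - 1) + 1)%N); last by lia.
    rewrite (_ : (n - i)%N = (n - i - 1).+1); last by lia.
    rewrite [((n - i - 1).+1 - 1)%N]subn1/= addn0 chainp chainq.
    rewrite weight_odd weight_even/=.
    by rewrite !exprS !exprMn; ring.
Qed.
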